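(* Let $(T,d)$ be a complete metric space, let $\alpha>0$, for each $t\in T$ let $\mathcal{H}_t$ be a Hilbert space and let $A_t$ be a bounded self-adjoint linear operator on $\mathcal{H}_t$, such that $\sup_{t\in T}\|A_t\|<\infty$. Suppose that $A=(A_t)_{t\in T}$ is p2-$\alpha$-Hölder continuous. Let $t_0\in T$ and let $c$ be an isolated gap tip of $A_{t_0}$. Then the widths of the gaps of $A_t$ closing on $c$ at $t_0$ are $\alpha/2$-Hölder continuous at $t_0$. Explicitly: if $U\subset T$ is a non-empty set with $t_0\in\overline{U}\setminus U$ and, for $t\in U$, $(a_t,b_t)$ with $a_t<b_t$ is a gap of $\sigma(A_t)$ such that $\lim_{t\to t_0}a_t=\lim_{t\to t_0}b_t=c$ (limits along $t\in U$), then there are $C\ge0$ and $r>0$ such that $$b_t-a_t\le C\,d(t,t_0)^{\alpha/2}\qquad\text{for all } t\in U \text{ with } d(t,t_0)<r.$$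
   Context: $\sigma(B)$ denotes the spectrum of $B$. A gap of a closed set $F\subset\mathbb{R}$ is a bounded connected component of $\mathbb{R}\setminus F$, i.e. an interval $(a,b)$ with $-\infty<a<b<\infty$, $a,b\in F$, $(a,b)\cap F=\emptyset$; its width is $b-a$. Gap tips: a gap tip of $A_{t_0}$ is a point $c\in\sigma(A_{t_0})$ for which there are a non-empty set $U\subset T$ with $t_0\in\overline{U}\setminus U$ and functions $t\in U\mapsto a_t\in\mathbb{R}$, $t\in U\mapsto b_t\in\mathbb{R}$ such that $a_t<b_t$, $\lim_{t\to t_0}a_t=\lim_{t\to t_0}b_t=c$, and $(a_t,b_t)$ is a gap of $\sigma(A_t)$ for $t\in U$; such gaps are said to close on $c$ at $t_0$. The gap tip $c$ is isolated if there is $\delta>0$ such that $(c-\delta,c+\delta)\subset\sigma(A_{t_0})$. Hölder functions: for metric spaces $(X,d_X)$, $(Y,d_Y)$ and $\alpha>0$, a function $f:X\to Y$ is $\alpha$-Hölder if $\mathrm{Hol}^\alpha(f)=\sup_{x\neq y}\frac{d_Y(f(x),f(y))}{d_X(x,y)^\alpha}<\infty$. A family $\mathcal{F}$ of functions $X\to Y$ is uniformly $\alpha$-Hölder if $\sup_{f\in\mathcal{F}}\mathrm{Hol}^\alpha(f)<\infty$. p2-$\alpha$-Hölder fields: for $M>0$ let $\mathscr{P}_2(M)$ be the set of polynomials $p(z)=p_0+p_1z+p_2z^2$ with $p_i\in\mathbb{R}$ and $\|p\|_1=|p_0|+|p_1|+|p_2|\le M$. The field $A$ is p2-$\alpha$-Hölder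 continuous if for every $M>0$ the maps $t\in T\mapsto\|p(A_t)\|$, $p\in\mathscr{P}_2(M)$, are uniformly $\alpha$-Hölder. *)

(* Defs.v *)
From HB Require Import structures.
From mathcomp Require Import all_boot all_order all_algebra sesquilinear complex.
From mathcomp Require Import all_classical all_reals all_analysis.

Set Implicit Arguments.
Unset Strict Implicit.
Unset Printing Implicit Defensive.

Import Order.TTheory GRing.Theory Num.Theory.
Import numFieldNormedType.Exports.

Local Open Scope classical_set_scope.
Local Open Scope complex_scope.
Local Open Scope ring_scope.

#[short(type="completeMetricType")]
HB.structure Definition CompleteMetric (K : numDomainType) :=
  {T of Metric K T & Complete T}.

(* The scalar field is R[i]; the inner product is linear in its first argument
   and conjugate-linear in its second one. *)
HB.mixin Record NormedModule_isHilbert (R : realType) H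
    & NormedModule (R[i]) H := {
  hdot : {dot H for @Num.conj R[i]} ;
  hdotxx : forall x : H, hdot x x = `|x| ^+ 2
}.

#[short(type="hilbertType")]
HB.structure Definition Hilbert (R : realType) :=
  {H of CompleteNormedModule (R[i]) H & NormedModule_isHilbert R H}.

Section operators.
Context {R : realType} {H : hilbertType R}.
Implicit Types f : H -> H.

(* The norm of a normed module over R[i] takes its values in R[i]. *)
Definition hnorm (x : H) : R := complex.Re `|x|.

Definition bounded_op f := exists M : R, forall x, hnorm (f x) <= M * hnorm x.

(* Meaningful for bounded linear f only: sup defaults to 0 on unbounded sets. *)
Definition opnorm f : R := sup [set hnorm (f x) | x in [set x | hnorm x <= 1]].

(* For an everywhere defined bounded operator this is A = A^*. *)
Definition self_adjoint f := forall x y : H, hdot (f x) y = hdot x (f y).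

Definition bounded_invertible f :=
  exists B : {linear H -> H}, [/\ bounded_op B, cancel f B & cancel B f].

Definition spectrum f : set R[i] :=
  [set z | ~ bounded_invertible (fun x => f x - z *: x)].

(* The spectrum as a subset of the real line; a self-adjoint operator has no
   other spectrum. *)
Definition real_spectrum f : set R := [set x | spectrum f x%:C].

Definition poly_op (p : {poly R}) f : H -> H :=
  fun x => \sum_(i < size p) (p`_i)%:C *: iter i f x.

End operators.

Section hoelder.
Context {R : realType}.

(* The supremum is taken in \bar R; it is -oo when X has at most one point. *)
Definition Hol {X Y : metricType R} (alpha : R) (f : X -> Y) : \bar R :=
  ereal_sup [set (mdist (f p.1) (f p.2) / mdist p.1 p.2 `^ alpha)%:E
            | p in [set p : X * X | p.1 != p.2]].

Definition uniformly_hoelder {X Y : metricType R} (alpha : R)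
    (F : set (X -> Y)) :=
  (ereal_sup [set Hol alpha f | f in F] < +oo)%E.

End hoelder.

(* (a, b) is a bounded connected component of the complement of F. *)
Definition is_gap {R : realType} (F : set R) (a b : R) :=
  [/\ a < b, F a, F b & `]a, b[ `&` F = set0].

Section fields.
Context {R : realType} {T : metricType R} {H : T -> hilbertType R}.
Implicit Types A : forall t, {linear H t -> H t}.

Definition P2 (M : R) : set {poly R} :=
  [set p | (size p <= 3)%N /\ `|p`_0| + `|p`_1| + `|p`_2| <= M].

(* R^o is the metric space (R, |x - y|). *)
Definition p2_hoelder (alpha : R) A :=
  forall M : R, 0 < M ->
    uniformly_hoelder alpha
      [set ((fun t => opnorm (poly_op p (A t))) : T -> R^o) | p in P2 M].

(* Only the values of a and b on U matter. *)
Definition gaps_close A (t0 : T) (c : R) (U : set T) (a b : T -> R) :=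
  [/\ U !=set0, closure U t0 /\ ~ U t0,
      forall t, U t -> is_gap (real_spectrum (A t)) (a t) (b t),
      a t @[t --> within U (nbhs t0)] --> c
    & b t @[t --> within U (nbhs t0)] --> c].

Definition gap_tip A (t0 : T) (c : R) :=
  real_spectrum (A t0) c /\ exists U a b, gaps_close A t0 c U a b.

(* Here "isolated" means interior to the spectrum of the limit operator. *)
Definition isolated_gap_tip A (t0 : T) (c : R) :=
  gap_tip A t0 c /\
  exists2 delta : R, 0 < delta &
    `]c - delta, c + delta[ `<=` real_spectrum (A t0).

End fields.

(* Main.v *)
Require Import Defs.
From HB Require Import structures.
From mathcomp Require Import all_boot all_order all_algebra sesquilinear complex.
From mathcomp Require Import all_classical all_reals all_analysis.
From mathcomp Require Import ring lra.

Set Implicit Arguments.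
Unset Strict Implicit.
Unset Printing Implicit Defensive.

Import Order.TTheory GRing.Theory Num.Theory.
Import numFieldNormedType.Exports.

Local Open Scope classical_set_scope.
Local Open Scope ring_scope.

(** Fix t in U, let s and h be the midpoint and the half-width of the gap of
A_t, and put B = A_t - s.  For N at least the norms of A_t - s and A_t0 - s,
the parabola p(z) = N^2 - (z - s)^2 is nonnegative on both spectra, and its
maximum N^2 is attained at s only.  Near t0 the point s is in the spectrum of
A_t0, because c is interior to it, so that ||p(A_t0)|| >= N^2
([opnorm_parabola_spectrum]).  On the spectrum of A_t the point s is avoided
by the distance h, so that ||p(A_t)|| <= N^2 - h^2 / 2
([opnorm_parabola_gap]).  The Hoelder bound for the norms of p(A_t) then gives
h^2 <= 2 L d(t, t0)^alpha, and the exponent is halved by the square root.  The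
coefficients of p stay bounded as t varies since s stays near c; this makes L
independent of t.

The exact value of ||p(A_t)|| is N^2 - h^2, by the functional calculus.  The
factor 1/2 is lost because the estimate is instead obtained by expanding
||(N^2 - B^2) x||^2, which only needs h ||x|| <= ||B x|| <= N ||x|| for all x.
Two facts on a bounded self-adjoint B link these estimates to the spectrum:

- if B is bounded below then B is invertible ([bounded_below_invertible]):
  B^2 x = y is solved by the iteration x |-> x + N^-2 (y - B^2 x), whose
  residual is multiplied at each step by the contraction 1 - N^-2 B^2;

- if B - m is invertible for all |m| < h then h ||x|| <= ||B x||
  ([bounded_below_of_gap]): were the best lower bound m of B smaller than h,
  then B^2 - m^2 = (B + m) (B - m) would be a nonnegative form that is bounded
  below as an operator; such a form is bounded below as a form, which improves
  m. *)

Local Open Scope complex_scope.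

(** * The underlying real inner product *)

Section RealInnerProduct.
Context {R : realType} {H : hilbertType R}.
Implicit Types (x y z : H) (k : R).

(** All spectral parameters below are real, and the real part of the inner
product is a real bilinear symmetric form with the same norm: it keeps every
estimate in the ordered field R. *)
Definition rdot x y : R := complex.Re (hdot x y).

Lemma normE x : `|x| = (hnorm x)%:C.
Proof. by rewrite /hnorm RRe_real// realE normr_ge0. Qed.

Lemma hnorm_ge0 x : 0 <= hnorm x.
Proof. by rewrite -ler0c -normE. Qed.

Lemma hnorm_eq0 x : hnorm x = 0 -> x = 0.
Proof. by move=> x0; apply/normr0_eq0; rewrite normE x0. Qed.

Lemma hnorm0 : hnorm (0 : H) = 0.
Proof. by rewrite /hnorm normr0. Qed.

Lemma hnormN x : hnorm (- x) = hnorm x.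
Proof. by rewrite /hnorm normrN. Qed.

Lemma hnormD x y : hnorm (x + y) <= hnorm x + hnorm y.
Proof. by rewrite -lecR rmorphD/= -!normE ler_normD. Qed.

Lemma hnormZ k x : hnorm (k%:C *: x) = `|k| * hnorm x.
Proof.
apply: complexI; rewrite rmorphM/= -!normE normrZ; congr (_ * _).
by rewrite normc_def/= expr0n/= addr0 sqrtr_sqr.
Qed.

Lemma rdotC x y : rdot x y = rdot y x.
Proof.
have ReJ (w : R[i]) : complex.Re (Num.conj w) = complex.Re w by case: w.
by rewrite /rdot (hermC (@hdot R H)) mul1r ReJ.
Qed.

Lemma rdotBZl k x y z : rdot (x - k%:C *: y) z = rdot x z - k * rdot y z.
Proof.
have ReB (v w : R[i]) : complex.Re (v - k%:C * w) =
    complex.Re v - k * complex.Re w.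
  by case: v w => [a b] [a' b'] /=; rewrite mul0r subr0.
by rewrite /rdot linearBl linearZl_LR ReB.
Qed.

Lemma rdotBZr k x y z : rdot z (x - k%:C *: y) = rdot z x - k * rdot z y.
Proof. by rewrite rdotC rdotBZl ![rdot z _]rdotC. Qed.

Lemma rdotZl k x y : rdot (k%:C *: x) y = k * rdot x y.
Proof.
by have := rdotBZl (- k) 0 x y; rewrite rmorphN scaleNr opprK add0r => ->;
  rewrite /rdot linear0l mulNr opprK add0r.
Qed.

Lemma rdotxx x : rdot x x = hnorm x ^+ 2.
Proof. by rewrite /rdot hdotxx normE -rmorphXn. Qed.

Lemma sqr_hnormBZ k x y :
  hnorm (x - k%:C *: y) ^+ 2 =
  hnorm x ^+ 2 - 2 * k * rdot x y + k ^+ 2 * hnorm y ^+ 2.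
Proof.
by rewrite -!rdotxx rdotBZl !rdotBZr [rdot y x]rdotC; ring.
Qed.

Lemma self_adjoint_rdot (f : H -> H) x y :
  self_adjoint f -> rdot (f x) y = rdot x (f y).
Proof. by move=> sa; rewrite /rdot sa. Qed.

(** The conclusion includes the rate, so that no limit has to be taken along
the operators applied to the sequence. *)
Lemma geometric_cvg (u : nat -> H) (C q : R) : 0 <= q < 1 ->
  (forall n, hnorm (u n.+1 - u n) <= C * q ^+ n) ->
  exists l, forall n, hnorm (l - u n) <= C / (1 - q) * q ^+ n.
Proof.
move=> /andP[q0 q1] uC.
have q1' : 0 < 1 - q by rewrite subr_gt0.
have C0 : 0 <= C by have := le_trans (hnorm_ge0 _) (uC 0%N); rewrite mulr1.
have um n m : hnorm (u (n + m)%N - u n) <= C / (1 - q) * q ^+ n.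
  suff : hnorm (u (n + m)%N - u n) <= C / (1 - q) * (q ^+ n - q ^+ (n + m)).
    move=> /le_trans; apply; apply: ler_wpM2l.
      by rewrite divr_ge0// ltW.
    by rewrite gerBl exprn_ge0.
  elim: m => [|m IH]; first by rewrite addn0 !subrr hnorm0 mulr0.
  rewrite addnS -[u _.+1](subrK (u (n + m)%N)) -addrA.
  apply: le_trans (hnormD _ _) _; apply: le_trans (lerD (uC _) IH) _.
  rewrite exprS le_eqVlt; apply/orP; left; apply/eqP; field.
  by rewrite gt_eqF.
have D0 : 0 <= C / (1 - q) by rewrite divr_ge0// ltW.
have qn (e : R) : 0 < e -> exists n0, forall n, (n0 <= n)%N ->
    C / (1 - q) * q ^+ n < e.
  move=> e0; have nq : `|q| < 1 by rewrite ger0_norm.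
  have /cvgrPdist_lt/(_ _ e0)[n0 _ n0P] := cvg_geometric (C / (1 - q)) nq.
  exists n0 => n /n0P /=; rewrite sub0r normrN ger0_norm//.
  by rewrite mulr_ge0 ?exprn_ge0.
have /cauchy_cvgP/cvgrPdist_lt ul : cauchy (u @ \oo).
  apply: cauchy_exP => e e0.
  have eE : e = (complex.Re e)%:C by rewrite RRe_real// gtr0_real.
  have {}e0 : 0 < complex.Re e by rewrite -ltcR -eE.
  have [n0 n0P] := qn _ e0; exists (u n0), n0 => //= m n0m.
  rewrite -ball_normE/= distrC normE eE ltcR -(subnKC n0m).
  exact: le_lt_trans (um _ _) (n0P _ (leqnn _)).
exists (lim (u @ \oo)) => n; apply/ler_addgt0Pr => e e0.
have [|n0 _ n0P] := ul e%:C; first by rewrite ltcR.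
have /= := n0P (n + n0)%N (leq_addl _ _); rewrite normE ltcR => h.
rewrite -[lim _](subrK (u (n + n0)%N)) -addrA addrC.
by rewrite (le_trans (hnormD _ _))// lerD// ltW.
Qed.

End RealInnerProduct.
(** * Lower bounds and invertibility of self-adjoint operators *)

Section SelfAdjoint.
Context {R : realType} {H : hilbertType R}.
Implicit Types (B : {linear H -> H}) (x y : H) (N e h k m s : R).

Lemma linear_realZ B k x : B (k%:C *: x) = k%:C *: B x.
Proof. exact: linearZ. Qed.

(** Expanding the square gives
||x||^2 - 2 N^-2 ||B x||^2 + N^-4 ||B^2 x||^2, where self-adjointness turns the
cross term into a norm; the last term is at most half of the middle one since
||B^2 x|| <= N ||B x||. *)
Lemma residual_contraction B N e x : self_adjoint B ->
  (forall x, hnorm (B x) <= N * hnorm x) ->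
  (forall x, e * hnorm x <= hnorm (B x)) -> 0 < N -> 0 <= e ->
  hnorm (x - (N ^- 2)%:C *: B (B x)) ^+ 2 <=
    (1 - e ^+ 2 / N ^+ 2) * hnorm x ^+ 2.
Proof.
move=> sa BN Be N0 e0; rewrite sqr_hnormBZ -self_adjoint_rdot// rdotxx.
have h1 : hnorm (B (B x)) ^+ 2 <= N ^+ 2 * hnorm (B x) ^+ 2.
  by rewrite -exprMn lerXn2r// nnegrE ?mulr_ge0 ?hnorm_ge0// ltW.
have h2 : e ^+ 2 * hnorm x ^+ 2 <= hnorm (B x) ^+ 2.
  by rewrite -exprMn lerXn2r// nnegrE ?mulr_ge0 ?hnorm_ge0.
have N2 : 0 < N ^- 2 by rewrite invr_gt0 exprn_gt0.
have h3 : N ^- 2 * hnorm (B (B x)) ^+ 2 <= hnorm (B x) ^+ 2.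
  by rewrite mulrC ler_pdivrMr ?exprn_gt0// mulrC.
move: N2 h1 h2 h3; set t := N ^- 2; set X := _ ^+ 2; set Y := _ ^+ 2.
set Z := hnorm (B _) ^+ 2 => N2 _ h2 h3.
nra.
Qed.

(** Working with B^2 instead of B makes the operator positive, which is what
the relaxed iteration needs to converge. *)
Lemma bounded_below_surjective B N e : self_adjoint B ->
  (forall x, hnorm (B x) <= N * hnorm x) -> 0 < e ->
  (forall x, e * hnorm x <= hnorm (B x)) -> forall y, exists x, B x = y.
Proof.
move=> sa BN e0 Be y.
(* A larger N is harmless and puts the contraction ratio strictly below 1. *)
wlog [N0 eN] : N BN / 0 < N /\ e < N.
  move=> /(_ (`|N| + e + 1)); apply; last first.
    by have := normr_ge0 N; split; lra.
  move=> x; apply: le_trans (BN x) _; apply: ler_wpM2r; first exact: hnorm_ge0.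
  by have := ler_norm N; lra.
pose t := N ^- 2.
pose q := Num.sqrt (1 - e ^+ 2 / N ^+ 2).
have eN2 : 0 < e ^+ 2 / N ^+ 2 < 1.
  rewrite divr_gt0 ?exprn_gt0//= ltr_pdivrMr ?exprn_gt0// mul1r.
  by rewrite ltr_pXn2r ?nnegrE ?(ltW N0)// ltW.
have q1 : 0 <= q < 1.
  by rewrite sqrtr_ge0/= -sqrtr1 ltr_sqrt//; lra.
have q2 : q ^+ 2 = 1 - e ^+ 2 / N ^+ 2 by rewrite sqr_sqrtr//; lra.
have step x : hnorm (x - t%:C *: B (B x)) <= q * hnorm x.
  have [q0 _] := andP q1.
  rewrite -(@ler_pXn2r _ 2)// ?nnegrE ?mulr_ge0 ?hnorm_ge0//.
  by rewrite exprMn q2; apply: residual_contraction => //; exact: ltW.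
pose u := fix u n : H := if n is n'.+1 then
  u n' + t%:C *: (y - B (B (u n'))) else 0.
pose r n := y - B (B (u n)).
have rS n : r n.+1 = r n - t%:C *: B (B (r n)).
  rewrite {1}/r /= -/(r n).
  by rewrite linearD linear_realZ linearD linear_realZ opprD addrA.
have rn n : hnorm (r n) <= hnorm y * q ^+ n.
  elim: n => [|n IH]; first by rewrite /r/= !linear0 addr0 mulr1.
  rewrite rS; apply: le_trans (step _) _; rewrite exprS mulrCA.
  by apply: ler_wpM2l => //; case/andP: q1.
have t0 : 0 < t by rewrite invr_gt0 exprn_gt0.
have [|l lP] := @geometric_cvg _ _ u (t * hnorm y) q q1.
  move=> n; rewrite /= addrAC subrr add0r hnormZ gtr0_norm// -mulrA.
  by apply: ler_wpM2l (rn n); exact: ltW.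
exists (B l); apply/eqP; rewrite -subr_eq0; apply/eqP/hnorm_eq0/eqP.
rewrite eq_le hnorm_ge0 andbT.
pose D := t * hnorm y / (1 - q) * N ^+ 2 + hnorm y.
have key n : hnorm (B (B l) - y) <= D * q ^+ n.
  have -> : B (B l) - y = B (B (l - u n)) - r n.
    by rewrite /r linearB linearB opprB addrA subrK.
  rewrite /D mulrDl; apply: le_trans (hnormD _ _) _; rewrite hnormN lerD//.
  apply: le_trans (BN _) _; rewrite expr2 [leRHS]mulrAC mulrA.
  rewrite [leRHS]mulrC mulrA mulrC.
  apply: ler_wpM2l (ltW N0) _ _ _; apply: le_trans (BN _) _.
  exact: ler_wpM2l (ltW N0) _ _ (lP n).
have nq : `|q| < 1 by case/andP: q1 => ? ?; rewrite ger0_norm.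
by apply: (cvgr_to_ge (cvg_geometric D nq)); apply: nearW.
Qed.

(** Injectivity and the bound on the inverse come from the lower bound itself;
linearity of the chosen preimage follows from injectivity. *)
Lemma bounded_below_invertible B N e : self_adjoint B ->
  (forall x, hnorm (B x) <= N * hnorm x) -> 0 < e ->
  (forall x, e * hnorm x <= hnorm (B x)) -> bounded_invertible B.
Proof.
move=> sa BN e0 Be.
have /choice[g Bg] := bounded_below_surjective sa BN e0 Be.
have Binj : injective B.
  move=> x y xy; apply/eqP; rewrite -subr_eq0; apply/eqP/hnorm_eq0/eqP.
  rewrite eq_le hnorm_ge0 andbT -(pmulr_rle0 _ e0).
  by apply: le_trans (Be _) _; rewrite linearB xy subrr hnorm0.
have glin : linear g.
  by move=> a x y; apply: Binj; rewrite Bg linearP !Bg.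
pose G : {linear H -> H} := HB.pack g (GRing.isLinear.Build _ _ _ _ g glin).
have gB : cancel B g by move=> x; apply: Binj; rewrite Bg.
exists G; split=> //.
exists e^-1 => x; rewrite ler_pdivlMl//.
by apply: le_trans (Be _) _; rewrite Bg.
Qed.

Lemma invertible_bounded_below (f : H -> H) : bounded_invertible f ->
  exists2 e, 0 < e & forall x, e * hnorm x <= hnorm (f x).
Proof.
move=> [G [[M GM] fG _]]; exists (`|M| + 1)^-1.
  by rewrite invr_gt0 ltr_wpDl.
move=> x; rewrite ler_pdivrMl ?ltr_wpDl// -{1}[x]fG.
apply: le_trans (GM _) _; apply: ler_wpM2r; first exact: hnorm_ge0.
by rewrite (le_trans (ler_norm _))// lerDl.
Qed.

(** A substitute for the Cauchy-Schwarz inequality of the form of P: evaluate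
the nonnegative form at x - K^-1 P x. *)
Lemma nonneg_form_bound (P : {linear H -> H}) (K : R) x : 0 < K ->
  self_adjoint P -> (forall y, 0 <= rdot (P y) y <= K * hnorm y ^+ 2) ->
  hnorm (P x) ^+ 2 <= K * rdot (P x) x.
Proof.
move=> K0 sa PK.
have /andP[+ _] := PK (x - (K^-1)%:C *: P x).
rewrite linearB linear_realZ rdotBZl !rdotBZr.
rewrite [rdot (P (P x)) x]self_adjoint_rdot// rdotxx.
have /andP[_ h] := PK (P x).
have K1 : 0 < K^-1 by rewrite invr_gt0.
have h1 : K^-1 * rdot (P (P x)) (P x) <= hnorm (P x) ^+ 2.
  by rewrite ler_pdivrMl.
move: h1; set X := hnorm _ ^+ 2; set Y := rdot _ _; set Z := rdot _ _.
move=> h1 h2; rewrite -ler_pdivrMl//.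
nra.
Qed.

Lemma bounded_below_of_gap B N h : self_adjoint B ->
  (forall x, hnorm (B x) <= N * hnorm x) ->
  (forall m, - h < m < h ->
    bounded_invertible (fun x => B x - m%:C *: x)) ->
  forall x, h * hnorm x <= hnorm (B x).
Proof.
move=> sa BN gap x0; rewrite leNgt; apply/negP => Bx0.
have x0_gt0 : 0 < hnorm x0.
  rewrite lt_def hnorm_ge0 andbT; apply: contraTneq Bx0 => ->.
  by rewrite mulr0 -leNgt hnorm_ge0.
(* The supremum m of S is the best lower bound of B; x0 keeps it below h. *)
pose S := [set m : R | 0 <= m /\ forall x, m * hnorm x <= hnorm (B x)].
have S0 : S 0 by split=> // x; rewrite mul0r hnorm_ge0.
have Sub m : S m -> m <= hnorm (B x0) / hnorm x0.
  by move=> [_ /(_ x0)]; rewrite ler_pdivlMr.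
have hS : has_sup S by split; [exists 0|exists (hnorm (B x0) / hnorm x0)].
pose m := sup S.
have m0 : 0 <= m by exact: ub_le_sup hS.2 _ S0.
have mh : m < h.
  apply: le_lt_trans (_ : hnorm (B x0) / hnorm x0 < h).
    by apply: ge_sup => //; exists 0.
  by rewrite ltr_pdivrMr.
have mB x : m * hnorm x <= hnorm (B x).
  have [->|x_neq0] := eqVneq (hnorm x) 0; first by rewrite mulr0 hnorm_ge0.
  have x_gt0 : 0 < hnorm x by rewrite lt_def x_neq0 hnorm_ge0.
  rewrite -ler_pdivlMr//; apply: ge_sup; first by exists 0.
  by move=> y [_ /(_ x)]; rewrite ler_pdivlMr.
have [|e1 e1_gt0 he1] := invertible_bounded_below (gap m _); first lra.
have [|e2 e2_gt0 he2] := invertible_bounded_below (gap (- m) _); first lra.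
pose P := (B \o B) \- ((m ^+ 2)%:C \*: idfun).
have PE x : P x = B (B x) - (m ^+ 2)%:C *: x by [].
have Pform x : rdot (P x) x = hnorm (B x) ^+ 2 - m ^+ 2 * hnorm x ^+ 2.
  by rewrite PE rdotBZl self_adjoint_rdot// !rdotxx.
have Psa : self_adjoint P.
  move=> x y; rewrite !PE linearBl linearBr linearZl_LR linearZr_LR /= !sa.
  by congr (_ - _ * _); rewrite -[RHS]/(conjc _) conjc_real.
have Pfac x : P x = (B (B x - m%:C *: x) - (- m)%:C *: (B x - m%:C *: x)).
  rewrite PE [B (_ - _)]linearB [B (_ *: x)]linear_realZ rmorphN.
  rewrite [(- _) *: _]scaleNr opprK scalerBr scalerA -rmorphM -expr2.
  by rewrite addrA subrK.
(* Both factors of P = (B + m) (B - m) are bounded below, as |m| < h. *)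
have [e e_gt0 Pe] : exists2 e, 0 < e & forall x, e * hnorm x <= hnorm (P x).
  exists (e1 * e2); first exact: mulr_gt0.
  move=> x; rewrite Pfac; apply: le_trans (he2 _); rewrite mulrAC mulrC.
  exact: ler_wpM2l (ltW e2_gt0) _ _ (he1 x).
(* Adding 1 makes K positive even when N is 0. *)
pose K := N ^+ 2 + 1.
have K0 : 0 < K by rewrite ltr_wpDl// sqr_ge0.
have PK y : 0 <= rdot (P y) y <= K * hnorm y ^+ 2.
  rewrite Pform subr_ge0 -!exprMn lerXn2r ?nnegrE ?mulr_ge0 ?hnorm_ge0//=.
  have : hnorm (B y) ^+ 2 <= N ^+ 2 * hnorm y ^+ 2.
    have h1 := le_trans (hnorm_ge0 _) (BN y).
    by rewrite -exprMn lerXn2r ?nnegrE ?hnorm_ge0.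
  rewrite /K exprMn; have := sqr_ge0 m; have := sqr_ge0 (hnorm y).
  move: (hnorm y ^+ 2) (hnorm (B y) ^+ 2) (m ^+ 2) (N ^+ 2) => *; nra.
(* e^2 ||x||^2 <= ||P x||^2 <= K (||B x||^2 - m^2 ||x||^2) improves m to m'. *)
pose m' := Num.sqrt (m ^+ 2 + e ^+ 2 / K).
have Sm' : S m'.
  split; first exact: sqrtr_ge0.
  move=> x; have h1 := nonneg_form_bound x K0 Psa PK.
  have h2 : e ^+ 2 * hnorm x ^+ 2 <= hnorm (P x) ^+ 2.
    by rewrite -exprMn lerXn2r ?nnegrE ?mulr_ge0 ?hnorm_ge0 ?(ltW e_gt0).
  suff : (m' * hnorm x) ^+ 2 <= hnorm (B x) ^+ 2.
    by rewrite ler_pXn2r ?nnegrE ?mulr_ge0 ?hnorm_ge0 ?sqrtr_ge0.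
  rewrite exprMn sqr_sqrtr ?addr_ge0 ?divr_ge0 ?sqr_ge0 ?(ltW K0)//.
  rewrite mulrDl [X in _ + X]mulrAC -lerBrDl ler_pdivrMr//.
  by rewrite -Pform [leRHS]mulrC (le_trans h2).
have : m' <= m by exact: ub_le_sup hS.2 _ Sm'.
rewrite leNgt => /negP; apply.
rewrite -(ger0_norm m0) -sqrtr_sqr ltr_sqrt ?ltrDl ?divr_gt0 ?exprn_gt0//.
by rewrite ltr_wpDl ?sqr_ge0 ?divr_gt0 ?exprn_gt0.
Qed.

(** * Norms of the quadratic polynomials *)

(** Expanding the square gives
N^4 ||x||^2 - 2 N^2 ||B x||^2 + ||B^2 x||^2 <= N^4 ||x||^2 - N^2 ||B x||^2
<= N^2 (N^2 - h^2) ||x||^2, which is at most (N^2 - h^2 / 2)^2 ||x||^2. *)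
Lemma hnorm_parabola_le B N h x : 0 <= h <= N ->
  (forall x, hnorm (B x) <= N * hnorm x) -> self_adjoint B ->
  h * hnorm x <= hnorm (B x) ->
  hnorm ((N ^+ 2)%:C *: x - B (B x)) <= (N ^+ 2 - h ^+ 2 / 2) * hnorm x.
Proof.
move=> /andP[h0 hN] BN sa hB.
have N0 := le_trans h0 hN.
have hN2 : h ^+ 2 <= N ^+ 2 by rewrite lerXn2r.
have h1 : hnorm (B (B x)) ^+ 2 <= N ^+ 2 * hnorm (B x) ^+ 2.
  by rewrite -exprMn lerXn2r ?nnegrE ?mulr_ge0 ?hnorm_ge0.
have h2 : h ^+ 2 * hnorm x ^+ 2 <= hnorm (B x) ^+ 2.
  by rewrite -exprMn lerXn2r ?nnegrE ?mulr_ge0 ?hnorm_ge0.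
have k0 : 0 <= N ^+ 2 - h ^+ 2 / 2 by have := sqr_ge0 h; lra.
suff : hnorm ((N ^+ 2)%:C *: x - B (B x)) ^+ 2 <=
    ((N ^+ 2 - h ^+ 2 / 2) * hnorm x) ^+ 2.
  by rewrite ler_pXn2r ?nnegrE ?mulr_ge0 ?hnorm_ge0.
rewrite -[B (B x)]scale1r -(rmorph1 (real_complex R)) sqr_hnormBZ.
rewrite rdotZl -(self_adjoint_rdot _ _ sa) rdotxx.
rewrite hnormZ ger0_norm ?sqr_ge0// !exprMn.
have := sqr_ge0 h; have := sqr_ge0 N; have := sqr_ge0 (hnorm x).
have := mulr_ge0 (sqr_ge0 (h ^+ 2)) (sqr_ge0 (hnorm x)).
have := ler_wpM2l (sqr_ge0 N) h2.
move: h1; set X := hnorm x ^+ 2; set Y := hnorm (B x) ^+ 2.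
set Z := hnorm _ ^+ 2; set M := N ^+ 2; set g := h ^+ 2.
nra.
Qed.

(** If k < N^2, then
N^2 ||x|| <= ||(N^2 - B^2) x|| + ||B^2 x|| <= k ||x|| + N ||B x|| bounds B from
below, hence makes it invertible. *)
Lemma parabola_bound_ge B N k : self_adjoint B -> 0 < N ->
  (forall x, hnorm (B x) <= N * hnorm x) -> ~ bounded_invertible B ->
  (forall x, hnorm ((N ^+ 2)%:C *: x - B (B x)) <= k * hnorm x) ->
  N ^+ 2 <= k.
Proof.
move=> sa N0 BN Binv Bk; rewrite leNgt; apply/negP => kN; apply: Binv.
apply: (bounded_below_invertible (e := (N ^+ 2 - k) / N) sa BN).
  by rewrite divr_gt0// subr_gt0.
move=> x; rewrite mulrAC ler_pdivrMr// mulrBl lerBlDr.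
have -> : N ^+ 2 * hnorm x = hnorm ((N ^+ 2)%:C *: x).
  by rewrite hnormZ ger0_norm// sqr_ge0.
rewrite -[_ *: x](subrK (B (B x))) addrC; apply: le_trans (hnormD _ _) _.
by rewrite lerD// [leRHS]mulrC.
Qed.

Lemma opnorm_le (f : H -> H) k : 0 <= k ->
  (forall x, hnorm (f x) <= k * hnorm x) -> opnorm f <= k.
Proof.
move=> k0 fk; apply: ge_sup.
  by exists (hnorm (f 0)); exists 0 => //=; rewrite hnorm0.
by move=> _ [x /= x1 <-]; rewrite (le_trans (fk x))// ler_piMr.
Qed.

Lemma hnorm_le_opnorm (f : {linear H -> H}) x : bounded_op f ->
  hnorm (f x) <= opnorm f * hnorm x.
Proof.
move=> [M fM]; have [x0|x_neq0] := eqVneq (hnorm x) 0.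
  by rewrite (hnorm_eq0 x0) linear0 hnorm0 mulr0.
have x_gt0 : 0 < hnorm x by rewrite lt_def x_neq0 hnorm_ge0.
rewrite -ler_pdivrMr// mulrC -[X in X * _]ger0_norm ?invr_ge0 ?hnorm_ge0//.
rewrite -hnormZ -linear_realZ; apply: ub_le_sup.
  exists `|M| => _ [y /= y1 <-]; apply: le_trans (fM y) _.
  apply: le_trans (ler_wpM2r (hnorm_ge0 _) (ler_norm M)) _.
  by rewrite ler_piMr.
exists ((hnorm x)^-1%:C *: x) => //=.
by rewrite hnormZ ger0_norm ?invr_ge0 ?hnorm_ge0// mulVf.
Qed.

(** * The parabola with its vertex in a gap or in the spectrum *)

Definition op_shift B s : {linear H -> H} := B \- (s%:C \*: idfun).

Lemma op_shift_self_adjoint B s : self_adjoint B -> self_adjoint (op_shift B s).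
Proof.
move=> sa x y; rewrite /op_shift/= linearBl linearBr linearZl_LR linearZr_LR/=.
rewrite sa.
by congr (_ - _ * _); rewrite -[RHS]/(conjc _) conjc_real.
Qed.

Lemma hnorm_op_shift B N s x : (forall x, hnorm (B x) <= N * hnorm x) ->
  hnorm (op_shift B s x) <= (N + `|s|) * hnorm x.
Proof.
move=> BN; apply: le_trans (hnormD _ _) _.
by rewrite hnormN hnormZ mulrDl lerD.
Qed.

Lemma op_shift_shift B s m x :
  op_shift B s x - m%:C *: x = B x - (s + m)%:C *: x.
Proof. by rewrite /op_shift/= rmorphD scalerDl opprD addrA. Qed.

(** The coefficients of N^2 - (z - s)^2. *)
Definition parabola N s : {poly R} := Poly [:: N ^+ 2 - s ^+ 2; 2 * s; -1].

Lemma polyseq_parabola N s :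
  parabola N s = [:: N ^+ 2 - s ^+ 2; 2 * s; -1] :> seq R.
Proof. by rewrite (@PolyK _ 0)//= oppr_eq0 oner_eq0. Qed.

Lemma poly_op_parabola B N s x :
  poly_op (parabola N s) B x = (N ^+ 2)%:C *: x - op_shift B s (op_shift B s x).
Proof.
rewrite /poly_op polyseq_parabola !big_ord_recl big_ord0/= /op_shift/=.
rewrite [B (_ - _)]linearB [B (_ *: x)]linear_realZ addr0.
have -> : (N ^+ 2 - s ^+ 2)%:C = (N ^+ 2)%:C - s%:C * s%:C.
  by rewrite -rmorphM -rmorphB -expr2.
have -> : (2 * s)%:C = s%:C + s%:C by rewrite mulr_natl mulr2n rmorphD.
rewrite [(-1)%:C]rmorphN rmorph1 scaleN1r scalerBl scalerDl scalerBr scalerA.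
move: (B x) (B (B x)) => u v.
by rewrite !opprB -addrA; congr (_ + _); rewrite !addrA [- _ + _]addrC.
Qed.

Lemma opnorm_parabola_gap B M N (a b : R) : self_adjoint B ->
  (forall x, hnorm (B x) <= M * hnorm x) -> is_gap (real_spectrum B) a b ->
  M + `|(a + b) / 2| <= N -> (b - a) / 2 <= N ->
  opnorm (poly_op (parabola N ((a + b) / 2)) B) <=
    N ^+ 2 - ((b - a) / 2) ^+ 2 / 2.
Proof.
set s := (a + b) / 2; set h := (b - a) / 2 => sa BM [ab _ _ gap] MN hN.
have h0 : 0 <= h by rewrite /h; lra.
have ssa := op_shift_self_adjoint s sa.
have sN x : hnorm (op_shift B s x) <= N * hnorm x.
  by apply: le_trans (hnorm_op_shift s x BM) _; rewrite ler_wpM2r// hnorm_ge0.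
have hs x : h * hnorm x <= hnorm (op_shift B s x).
  apply: bounded_below_of_gap ssa sN _ x => m mh; apply: contrapT => minv.
  have : (`]a, b[ `&` real_spectrum B) (s + m).
    split; first by rewrite /= in_itv/= /s; move: mh; rewrite /h; lra.
    move=> inv; apply: minv; move: inv; congr bounded_invertible.
    by apply/funext => y; rewrite op_shift_shift.
  by rewrite gap.
apply: opnorm_le.
  have : h ^+ 2 <= N ^+ 2 by rewrite lerXn2r ?nnegrE// (le_trans h0).
  by have := sqr_ge0 h; lra.
move=> x; rewrite poly_op_parabola.
by apply: hnorm_parabola_le => //; rewrite h0.
Qed.

Lemma opnorm_parabola_spectrum B M N s : self_adjoint B ->
  (forall x, hnorm (B x) <= M * hnorm x) -> real_spectrum B s ->
  0 < N -> M + `|s| <= N -> N ^+ 2 <= opnorm (poly_op (parabola N s) B).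
Proof.
move=> sa BM sB N0 MN.
have sN x : hnorm (op_shift B s x) <= N * hnorm x.
  by apply: le_trans (hnorm_op_shift s x BM) _; rewrite ler_wpM2r// hnorm_ge0.
apply: (parabola_bound_ge (op_shift_self_adjoint s sa) N0 sN sB) => x.
pose Q : {linear H -> H} :=
  ((N ^+ 2)%:C \*: idfun) \- (op_shift B s \o op_shift B s).
have QE : poly_op (parabola N s) B = Q.
  by apply/funext => y; rewrite poly_op_parabola.
rewrite QE; apply: (hnorm_le_opnorm (f := Q)); exists (N ^+ 2 + N ^+ 2) => y.
apply: le_trans (hnormD _ _) _; rewrite hnormN mulrDl lerD//.
  by rewrite hnormZ ger0_norm// sqr_ge0.
apply: le_trans (sN _) _; rewrite expr2 -mulrA.
exact: ler_wpM2l (ltW N0) _ _ (sN y).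
Qed.

End SelfAdjoint.

(** * The gap estimate *)

Lemma uniformly_hoelderP (R : realType) (X Y : metricType R) (alpha : R)
    (F : set (X -> Y)) : uniformly_hoelder alpha F ->
  exists2 L : R, 0 <= L & forall f, F f -> forall x y,
    mdist (f x) (f y) <= L * mdist x y `^ alpha.
Proof.
rewrite /uniformly_hoelder; set S := ereal_sup _ => Sfin.
exists `|fine S| => // f Ff x y; have [->|xy] := eqVneq x y.
  by rewrite mdistxx mulr_ge0// powR_ge0.
have d0 : 0 < mdist x y by rewrite mdist_gt0.
rewrite -ler_pdivrMr ?powR_gt0//; apply: le_trans (ler_norm _).
have : ((mdist (f x) (f y) / mdist x y `^ alpha)%:E <= S)%E.
  apply: le_trans (_ : (Hol alpha f <= S)%E).
    by apply: ereal_sup_ubound; exists (x, y).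
  by apply: ereal_sup_ubound; exists f.
by case: S Sfin.
Qed.

Local Close Scope complex_scope.

Theorem theorem5 (R : realType) (T : completeMetricType R) (alpha : R)
    (alpha_gt0 : 0 < alpha) (H : T -> hilbertType R)
    (A : forall t : T, {linear H t -> H t})
    (A_bounded : forall t : T, bounded_op (A t))
    (A_self_adjoint : forall t : T, self_adjoint (A t))
    (A_sup : has_ubound (range (fun t : T => opnorm (A t))))
    (A_p2 : p2_hoelder alpha A)
    (t0 : T) (c : R) (c_tip : isolated_gap_tip A t0 c)
    (U : set T) (a b : T -> R) (ab_close : gaps_close A t0 c U a b) :
  exists C r : R, [/\ 0 <= C, 0 < r &
    forall t : T, U t -> mdist t t0 < r ->
      b t - a t <= C * mdist t t0 `^ (alpha / 2)].
Proof.
have [M AM] := A_sup.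
have {}AM t x : hnorm (A t x) <= `|M| * hnorm x.
  apply: le_trans (hnorm_le_opnorm _ (A_bounded t)) _.
  apply: ler_wpM2r; first exact: hnorm_ge0.
  by apply: le_trans (ler_norm M); apply: AM; exists t.
have [_ [delta delta0 c_spec]] := c_tip.
have [_ _ gaps /cvgrPdist_lt a_c /cvgrPdist_lt b_c] := ab_close.
(* eta <= delta puts the midpoint s in the spectrum of A t0; eta <= 1 keeps
   |s| <= |c| + 1 and the half-width h <= 1 <= N. *)
pose eta := Num.min delta 1.
have eta0 : 0 < eta by rewrite lt_min delta0 ltr01.
pose N := `|M| + `|c| + 1.
have N1 : 1 <= N by rewrite /N lerDr addr_ge0.
(* A bound on |N^2 - s^2| + |2 s| + 1 that does not depend on s. *)
pose K := N ^+ 2 + N ^+ 2 + 2 * N + 1.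
have [|L L0 LP] := uniformly_hoelderP (A_p2 K _).
  by rewrite ltr_wpDl// !addr_ge0 ?sqr_ge0// mulr_ge0//; lra.
have [r r0 rP] : exists2 r : R, 0 < r & forall t, U t -> mdist t t0 < r ->
    `|c - a t| < eta /\ `|c - b t| < eta.
  have : \near t0, U t0 -> `|c - a t0| < eta /\ `|c - b t0| < eta.
    exact: (filterI (a_c _ eta0) (b_c _ eta0)).
  move=> /metricType_numDomainType.nbhs_mdistP[r r0 rP].
  by exists r => // t Ut tr; apply: rP => //=; rewrite metric_sym.
exists (Num.sqrt (8 * L)), r; split=> //.
move=> t Ut /(rP t Ut)[]; rewrite !ltr_norml => /andP[ac1 ac2] /andP[bc1 bc2].
have [etad eta1] : eta <= delta /\ eta <= 1 by split; rewrite ge_min lexx ?orbT.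
pose s := (a t + b t) / 2; pose h := (b t - a t) / 2.
have [ab _ _ _] := gaps t Ut.
have spec : real_spectrum (A t0) s.
  by apply: c_spec; rewrite /= in_itv/= /s; apply/andP; split; lra.
have sN : `|M| + `|s| <= N.
  have sc : `|s - c| <= 1 by rewrite ler_norml /s; apply/andP; split; lra.
  by have := ler_normD (s - c) c; rewrite subrK /N; lra.
have hN : h <= N by apply: le_trans N1; rewrite /h; lra.
have h1 := opnorm_parabola_gap (A_self_adjoint t) (AM t) (gaps t Ut) sN hN.
have h2 := opnorm_parabola_spectrum (A_self_adjoint t0) (AM t0) spec
  (lt_le_trans ltr01 N1) sN.
have parabolaK : P2 K (parabola N s).
  rewrite /P2/= polyseq_parabola; split=> //=.
  have sN' : `|s| <= N by apply: le_trans sN; rewrite lerDr.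
  have s2 : s ^+ 2 <= N ^+ 2.
    by rewrite -(real_normK (num_real s)) lerXn2r ?nnegrE// (le_trans _ sN').
  rewrite normrN1 normrM normr_nat [`|_ - _|]ger0_norm ?subr_ge0// /K.
  by have := sqr_ge0 s; have := sqr_ge0 N; lra.
have h3 : `|opnorm (poly_op (parabola N s) (A t0)) -
    opnorm (poly_op (parabola N s) (A t))| <= L * mdist t t0 `^ alpha.
  exact: LP _ (ex_intro2 _ _ _ parabolaK erefl) t t0.
have {}h3 := le_trans (ler_norm _) h3.
have h4 : (b t - a t) ^+ 2 <= 8 * L * mdist t t0 `^ alpha.
  move: h1; rewrite -/s -/h => h1.
  have -> : (b t - a t) ^+ 2 = 8 * (h ^+ 2 / 2) by rewrite /h; field.
  rewrite -mulrA; apply: ler_wpM2l => //.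
  by move: h3 h2 h1; lra.
have ba0 : 0 <= b t - a t by lra.
rewrite -(ger0_norm ba0) -sqrtr_sqr powRrM powR12_sqrt ?powR_ge0//.
by rewrite -sqrtrM ?mulr_ge0// ler_wsqrtr.
Qed.
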